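(* Let $\mathbb H$ be the division ring of quaternions over the real field. The map $f:\mathbb H\to\mathbb H$, $f(x)=\overline x$ (quaternion conjugation), has the Gâteaux derivative $$\partial(\overline x)(h)=-\frac12\,(h+ihi+jhj+khk),\qquad h\in\mathbb H.$$
   Context: $\mathbb H$ has real basis $1,i,j,k$ with $i^2=j^2=k^2=-1$, $ij=k=-ji$, $jk=i=-kj$, $ki=j=-ik$; the conjugate of $x=x^0+x^1i+x^2j+x^3k$ is $\overline x=x^0-x^1i-x^2j-x^3k$, and $|x|^2=x\overline x$. A map $f:\mathbb H\to\mathbb H$ is differentiable in the Gâteaux sense if at every point $x$ one has $f(x+a)-f(x)=\partial f(x)(a)+o(a)$, where the map $a\mapsto\partial f(x)(a)$ (the Gâteaux derivative of $f$ at $x$) is linear, i.e. additive and homogeneous over the center $\mathbb R$ of $\mathbb H$, and $o:\mathbb H\to\mathbb H$ is a continuous map with $\lim_{a\to0}|o(a)|/|a|=0$. *)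

(* Defs.v *)
From HB Require Import structures.
From mathcomp Require Import all_boot all_order all_algebra.
From mathcomp Require Import ring lra.
From mathcomp Require Import all_classical all_reals all_analysis.

Set Implicit Arguments.
Unset Strict Implicit.
Unset Printing Implicit Defensive.

Import Order.TTheory GRing.Theory Num.Theory numFieldNormedType.Exports.
Local Open Scope classical_set_scope.
Local Open Scope ring_scope.

(* [Quat x0 x1 x2 x3] stands for x0 + x1 i + x2 j + x3 k. *)
Record quat (R : realType) := Quat { q0 : R; q1 : R; q2 : R; q3 : R }.

Section QuatAlgebra.
Variable R : realType.
Implicit Types (x y z : quat R) (a b : R).

Definition quat_to_tuple x := (q0 x, q1 x, q2 x, q3 x).
Definition tuple_to_quat (t : R * R * R * R) :=
  let: (a, b, c, d) := t in Quat a b c d.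

Lemma quat_to_tupleK : cancel quat_to_tuple tuple_to_quat.
Proof. by case. Qed.

HB.instance Definition _ := Choice.copy (quat R) (can_type quat_to_tupleK).

Definition addq x y :=
  Quat (q0 x + q0 y) (q1 x + q1 y) (q2 x + q2 y) (q3 x + q3 y).
Definition oppq x := Quat (- q0 x) (- q1 x) (- q2 x) (- q3 x).

Lemma addqA : associative addq.
Proof. by case=> ? ? ? ? [? ? ? ?] [? ? ? ?]; congr Quat; rewrite /= addrA. Qed.
Lemma addqC : commutative addq.
Proof. by case=> ? ? ? ? [? ? ? ?]; congr Quat; rewrite /= addrC. Qed.
Lemma add0q : left_id (Quat 0 0 0 0) addq.
Proof. by case=> ? ? ? ?; congr Quat; rewrite /= add0r. Qed.
Lemma addNq : left_inverse (Quat 0 0 0 0) oppq addq.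
Proof. by case=> ? ? ? ?; congr Quat; rewrite /= addNr. Qed.

HB.instance Definition _ := GRing.isZmodule.Build (quat R) addqA addqC add0q addNq.

Definition mulq x y := Quat
  (q0 x * q0 y - q1 x * q1 y - q2 x * q2 y - q3 x * q3 y)
  (q0 x * q1 y + q1 x * q0 y + q2 x * q3 y - q3 x * q2 y)
  (q0 x * q2 y - q1 x * q3 y + q2 x * q0 y + q3 x * q1 y)
  (q0 x * q3 y + q1 x * q2 y - q2 x * q1 y + q3 x * q0 y).

Lemma mulqA : associative mulq.
Proof. by case=> ? ? ? ? [? ? ? ?] [? ? ? ?]; congr Quat => /=; ring. Qed.
Lemma mul1q : left_id (Quat 1 0 0 0) mulq.
Proof. by case=> ? ? ? ?; congr Quat => /=; ring. Qed.
Lemma mulq1 : right_id (Quat 1 0 0 0) mulq.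
Proof. by case=> ? ? ? ?; congr Quat => /=; ring. Qed.
Lemma mulqDl : left_distributive mulq addq.
Proof. by case=> ? ? ? ? [? ? ? ?] [? ? ? ?]; congr Quat => /=; ring. Qed.
Lemma mulqDr : right_distributive mulq addq.
Proof. by case=> ? ? ? ? [? ? ? ?] [? ? ? ?]; congr Quat => /=; ring. Qed.
Lemma oneq_neq0 : Quat 1 0 0 0 != 0 :> quat R.
Proof. by apply/eqP => -[] /eqP; rewrite oner_eq0. Qed.

HB.instance Definition _ := GRing.Zmodule_isNzRing.Build (quat R)
  mulqA mul1q mulq1 mulqDl mulqDr oneq_neq0.

Definition scaleq a x := Quat (a * q0 x) (a * q1 x) (a * q2 x) (a * q3 x).

Lemma scaleqA a b x : scaleq a (scaleq b x) = scaleq (a * b) x.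
Proof. by case: x => ? ? ? ?; congr Quat; rewrite /= mulrA. Qed.
Lemma scale1q : left_id 1 scaleq.
Proof. by case=> ? ? ? ?; congr Quat; rewrite /= mul1r. Qed.
Lemma scaleqDr : right_distributive scaleq +%R.
Proof. by move=> ? [? ? ? ?] [? ? ? ?]; congr Quat; rewrite /= mulrDr. Qed.
Lemma scaleqDl x : {morph scaleq^~ x : a b / a + b}.
Proof. by case: x => ? ? ? ? ? ?; congr Quat; rewrite /= mulrDl. Qed.

HB.instance Definition _ := GRing.Zmodule_isLmodule.Build R (quat R)
  scaleqA scale1q scaleqDr scaleqDl.

Lemma scaleqAl a x y : a *: (x * y) = (a *: x) * y.
Proof. by case: x y => ? ? ? ? [? ? ? ?]; congr Quat => /=; ring. Qed.
HB.instance Definition _ := GRing.Lmodule_isLalgebra.Build R (quat R) scaleqAl.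

Lemma scaleqAr a x y : a *: (x * y) = x * (a *: y).
Proof. by case: x y => ? ? ? ? [? ? ? ?]; congr Quat => /=; ring. Qed.
HB.instance Definition _ := GRing.Lalgebra_isAlgebra.Build R (quat R) scaleqAr.

Definition qi : quat R := Quat 0 1 0 0.
Definition qj : quat R := Quat 0 0 1 0.
Definition qk : quat R := Quat 0 0 0 1.

Lemma quatE x : x = (q0 x)%:A + q1 x *: qi + q2 x *: qj + q3 x *: qk.
Proof. by case: x => ? ? ? ?; congr Quat => /=; ring. Qed.

Lemma qi2 : qi ^+ 2 = -1. Proof. by congr Quat => /=; ring. Qed.
Lemma qj2 : qj ^+ 2 = -1. Proof. by congr Quat => /=; ring. Qed.
Lemma qk2 : qk ^+ 2 = -1. Proof. by congr Quat => /=; ring. Qed.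
Lemma qij : qi * qj = qk. Proof. by congr Quat => /=; ring. Qed.
Lemma qji : qj * qi = - qk. Proof. by congr Quat => /=; ring. Qed.
Lemma qjk : qj * qk = qi. Proof. by congr Quat => /=; ring. Qed.
Lemma qkj : qk * qj = - qi. Proof. by congr Quat => /=; ring. Qed.
Lemma qki : qk * qi = qj. Proof. by congr Quat => /=; ring. Qed.
Lemma qik : qi * qk = - qj. Proof. by congr Quat => /=; ring. Qed.

Definition conjq x : quat R := Quat (q0 x) (- q1 x) (- q2 x) (- q3 x).

Definition sqnormq x : R := q0 x ^+ 2 + q1 x ^+ 2 + q2 x ^+ 2 + q3 x ^+ 2.
Definition normq x : R := Num.sqrt (sqnormq x).

Lemma sqnormq_ge0 x : 0 <= sqnormq x.
Proof. by rewrite /sqnormq !addr_ge0 ?sqr_ge0. Qed.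

Lemma sqnormq_eq0 x : sqnormq x = 0 -> x = 0.
Proof.
case: x => a b c d; rewrite /sqnormq /= => /eqP.
rewrite !paddr_eq0 ?addr_ge0 ?sqr_ge0 // !sqrf_eq0.
by case/andP=> /andP[/andP[/eqP-> /eqP->] /eqP->] /eqP->.
Qed.

Lemma mul_conjq x : x * conjq x = (sqnormq x)%:A.
Proof. by case: x => ? ? ? ?; congr Quat => /=; rewrite ?/sqnormq /=; ring. Qed.

Lemma mul_conjq_l x : conjq x * x = (sqnormq x)%:A.
Proof. by case: x => ? ? ? ?; congr Quat => /=; rewrite ?/sqnormq /=; ring. Qed.

Definition invq x : quat R :=
  if x == 0 then x else (sqnormq x)^-1 *: conjq x.

Let sqnormq_neq0 x : x != 0 -> sqnormq x != 0.
Proof. by apply: contra_neq => /sqnormq_eq0. Qed.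

Lemma mulVq : {in [pred x | x != 0], left_inverse 1 invq *%R}.
Proof.
move=> x; rewrite inE => x0.
by rewrite /invq (negbTE x0) -scalerAl mul_conjq_l scalerA mulVf ?scale1r ?sqnormq_neq0.
Qed.
Lemma mulqV : {in [pred x | x != 0], right_inverse 1 invq *%R}.
Proof.
move=> x; rewrite inE => x0.
by rewrite /invq (negbTE x0) -scalerAr mul_conjq scalerA mulVf ?scale1r ?sqnormq_neq0.
Qed.
Lemma unitqP x y : y * x = 1 /\ x * y = 1 -> x != 0.
Proof. by case=> yx _; apply/eqP => x0; move/eqP: yx; rewrite x0 mulr0 eq_sym oner_eq0. Qed.
Lemma invq_out : {in [predC [pred x | x != 0]], invq =1 id}.
Proof. by move=> x; rewrite !inE negbK /invq => ->. Qed.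

(* Together with [quat_unit] below: a division ring. *)
HB.instance Definition _ := GRing.NzRing_hasMulInverse.Build (quat R)
  mulVq mulqV unitqP invq_out.

Lemma quat_unit x : (x \is a GRing.unit) = (x != 0).
Proof. by []. Qed.

Lemma quat_center x : (forall y, x * y = y * x) <-> exists a, x = a%:A.
Proof.
split=> [cx|[a ->] y]; last by rewrite mulr_algl mulr_algr.
exists (q0 x); have := cx qi; have := cx qj.
case: x {cx} => a b c d [] /= ? ? ? ? [] /= ? ? ? ?.
by congr Quat => /=; lra.
Qed.

Lemma ler_normqD x y : normq (x + y) <= normq x + normq y.
Proof.
have s0 z : 0 <= normq z by exact: sqrtr_ge0.
rewrite -(@ler_pXn2r _ 2%N) ?nnegrE ?addr_ge0 //.
rewrite sqrrD !sqr_sqrtr ?sqnormq_ge0 // -[normq x * _]sqrtrM ?sqnormq_ge0 //.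
set p := q0 x * q0 y + q1 x * q1 y + q2 x * q2 y + q3 x * q3 y.
have -> : sqnormq (x + y) = sqnormq x + p *+ 2 + sqnormq y.
  by rewrite /sqnormq /p /=; ring.
rewrite lerD2r lerD2l lerMn2r /=.
apply: (le_trans (ler_norm p)); rewrite -sqrtr_sqr ler_sqrt; last first.
  by rewrite mulr_ge0 ?sqnormq_ge0.
(* Lagrange's identity *)
rewrite -subr_ge0 [leRHS](_ : _ =
    (q0 x * q1 y - q1 x * q0 y) ^+ 2 + (q0 x * q2 y - q2 x * q0 y) ^+ 2
  + (q0 x * q3 y - q3 x * q0 y) ^+ 2 + (q1 x * q2 y - q2 x * q1 y) ^+ 2
  + (q1 x * q3 y - q3 x * q1 y) ^+ 2 + (q2 x * q3 y - q3 x * q2 y) ^+ 2).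
  by rewrite !addr_ge0 ?sqr_ge0.
by rewrite /sqnormq /p; ring.
Qed.

Lemma normqZ a x : normq (a *: x) = `|a| * normq x.
Proof.
rewrite /normq -sqrtr_sqr -sqrtrM ?sqr_ge0 //; congr Num.sqrt.
by rewrite /sqnormq /=; ring.
Qed.

Lemma normq_eq0 x : normq x = 0 -> x = 0.
Proof.
move=> /eqP; rewrite sqrtr_eq0 => x0; apply: sqnormq_eq0.
by apply/eqP; rewrite eq_le x0 sqnormq_ge0.
Qed.

HB.instance Definition _ := Lmodule_isNormed.Build R (quat R)
  ler_normqD normqZ normq_eq0.

Lemma quat_normE x : (`|x| ^+ 2)%:A = x * conjq x.
Proof. by rewrite mul_conjq sqr_sqrtr ?sqnormq_ge0. Qed.

End QuatAlgebra.

Arguments qi {R}.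
Arguments qj {R}.
Arguments qk {R}.

Section Gateaux.
Variable R : realType.
Local Notation H := (quat R).

(* [linear] is over R, the center of the quaternions (see [quat_center]). *)
Definition is_gateaux_derivative (f : H -> H) (x : H) (D : H -> H) : Prop :=
  linear D /\
  exists o : H -> H,
    [/\ continuous o,
        `|o a| / `|a| @[a --> (0 : H)^'] --> (0 : R) &
        forall a, f (x + a) - f x = D a + o a].

Definition gateaux_differentiable (f : H -> H) : Prop :=
  forall x, exists D, is_gateaux_derivative f x D.

(* Junk value when f has no derivative at x. *)
Definition gateaux_derivative (f : H -> H) (x : H) : H -> H :=
  get [set D | is_gateaux_derivative f x D].

End Gateaux.

(* Main.v *)
Require Import Defs.
From HB Require Import structures.
From mathcomp Require Import all_boot all_order all_algebra.
From mathcomp Require Import ring.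
From mathcomp Require Import all_classical all_reals all_analysis.
Import Order.TTheory GRing.Theory Num.Theory numFieldNormedType.Exports.
Local Open Scope ring_scope.

(** Conjugation is linear over the reals, so its increment at any point x along
    a is exactly the conjugate of a: conjugation is its own Gateaux derivative,
    with zero remainder.  The stated formula is then the identity
    [conjq_sandwich], which expresses conjugation through the two-sided
    multiplications by the basis: the maps h |-> u h u for u = i, j, k negate
    the real part and the u-coordinate of h and fix the other two coordinates,
    so adding the three images to h gives -2 times the conjugate of h.

    The derivative at x is by definition some linear map chosen among those
    that approximate the increment, so its uniqueness is needed as well.  Two
    candidates differ by a linear map that is negligible with respect to its
    argument at 0, and such a map D vanishes because the quotient |D a| / |a| is
    constant along every open ray from 0 ([linear_negligible_eq0]). *)

(** The quotient |D a| / |a| is invariant under scaling of a, so its value at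
    any nonzero h is attained arbitrarily close to 0, where it is as small as
    desired. *)
Lemma linear_negligible_eq0 (R : realFieldType) (V W : normedModType R)
    (D : {linear V -> W}) :
  (`|D a| / `|a| @[a --> (0 : V)^'] --> (0 : R))%classic ->
  forall h, D h = 0.
Proof.
move=> D0 h; have [->|h0] := eqVneq h 0; first exact: raddf0.
apply/eqP; apply: contraT => Dh0.
have nh : 0 < `|h| by rewrite normr_gt0.
have e0 : 0 < `|D h| / `|h| by rewrite divr_gt0 ?normr_gt0.
have /cvgr0Pnorm_lt/(_ _ e0)/nbhs_normP[d /= d0 Dlt] := D0.
have quotE t : 0 < t -> `|D (t *: h)| / `|t *: h| = `|D h| / `|h|.
  move=> t0; rewrite linearZ_LR !normrZ (gtr0_norm t0).
  by rewrite -mulf_div divff ?mul1r// gt_eqF.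
(* A positive multiple of h of norm d / 2, inside the ball of radius d. *)
pose t := d / 2 / `|h|.
have t0 : 0 < t by rewrite !divr_gt0.
have th_ball : `|0 - t *: h| < d.
  rewrite sub0r normrN normrZ (gtr0_norm t0) divfK ?gt_eqF//.
  by rewrite gtr_pMr// invf_lt1// ltr1n.
have th0 : t *: h != 0 by rewrite scaler_eq0 negb_or h0 gt_eqF.
by have := Dlt _ th_ball th0; rewrite quotE// ger0_norm ?ltxx// ltW.
Qed.

(** The difference of two derivatives is also a difference of their remainders,
    which makes it both linear and negligible at 0. *)
Lemma is_gateaux_derivative_unique {R : realType} [f : quat R -> quat R]
    [x : quat R] [D1 D2 : quat R -> quat R] :
  is_gateaux_derivative f x D1 -> is_gateaux_derivative f x D2 -> D1 =1 D2.
Proof.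
case=> lin1 [r1 [_ r1to0 fD1]] [lin2 [r2 [_ r2to0 fD2]]] h.
pose L1 : {linear quat R -> quat R} :=
  HB.pack D1 (GRing.isLinear.Build _ _ _ _ D1 lin1).
pose L2 : {linear quat R -> quat R} :=
  HB.pack D2 (GRing.isLinear.Build _ _ _ _ D2 lin2).
apply/eqP; rewrite -subr_eq0; apply/eqP.
apply: (@linear_negligible_eq0 _ _ _ (L1 \- L2)) => /=.
have diffE a : D1 a - D2 a = r2 a - r1 a.
  apply/eqP; rewrite subr_eq addrAC [X in _ == X - _]addrC -fD2 fD1.
  by rewrite addrK.
have rto0 : (`|r2 a| / `|a| + `|r1 a| / `|a|
    @[a --> (0 : quat R)^'] --> (0 + 0 : R))%classic by exact: cvgD.
rewrite addr0 in rto0.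
apply: (squeeze_cvgr _ _ rto0); [apply: nearW => a /=|exact: cvg_cst].
rewrite diffE divr_ge0//= -mulrDl ler_wpM2r ?invr_ge0//.
exact: ler_normB.
Qed.

Lemma conjq_linear {R : realType} : linear (@conjq R).
Proof. by move=> a [? ? ? ?] [? ? ? ?]; congr Quat => /=; ring. Qed.

(** By additivity the approximation is exact, so the zero remainder works. *)
Lemma linear_is_gateaux_derivative {R : realType} (D : quat R -> quat R)
    (x : quat R) :
  linear D -> is_gateaux_derivative D x D.
Proof.
move=> linD; split=> //; exists (fun=> 0); split.
- exact: cst_continuous.
- by apply: cvg_near_cst; apply: nearW => a; rewrite normr0 mul0r.
- by move=> a; rewrite -{1}[x]scale1r linD scale1r addrAC subrr add0r addr0.
Qed.

Lemma conjq_sandwich {R : realType} (h : quat R) :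
  conjq h = - (2^-1 : R) *: (h + qi * h * qi + qj * h * qj + qk * h * qk).
Proof. by case: h => ? ? ? ?; congr Quat => /=; field. Qed.

Theorem theorem14p2 (R : realType) :
  gateaux_differentiable (@conjq R) /\
  forall x h : quat R,
    gateaux_derivative (@conjq R) x h
      = - (2^-1 : R) *: (h + qi * h * qi + qj * h * qj + qk * h * qk).
Proof.
have dconj x := linear_is_gateaux_derivative _ x (@conjq_linear R).
split=> [x|x h]; first by exists (@conjq R).
rewrite -conjq_sandwich.
have dchosen :
    is_gateaux_derivative (@conjq R) x (gateaux_derivative (@conjq R) x).
  exact: (getPex (ex_intro _ _ (dconj x))).
exact: is_gateaux_derivative_unique dchosen (dconj x) h.
Qed.
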